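(* Let $F$ be a field, $n\geqslant 2$, and let $T_n$ be the ring of lower triangular $n\times n$ matrices over $F$. Let $(A,B)$ and $(C,D)$ be two distinguished pairs in ${}^2T_n$. Then the free cyclic submodules $T_n(A,B)$ and $T_n(C,D)$ are representatives of distinct $GL_2(T_n)$-orbits if, and only if, $(A,B)\neq (C,D)$.
   Context: ${}^2T_n$ is the free left $T_n$-module of pairs $(A,B)$ with $A,B\in T_n$. The cyclic submodule generated by $(A,B)$ is $T_n(A,B)=\{(XA,XB): X\in T_n\}$; it is called free if $(XA,XB)=(0,0)$ with $X\in T_n$ implies $X=0$. The group $GL_2(T_n)$ of invertible $2\times 2$ matrices over $T_n$ acts on ${}^2T_n$ from the right by $(A,B)\begin{bmatrix} X & Y \\ W & Z \end{bmatrix}=(AX+BW,\,AY+BZ)$, and hence acts on the set of free cyclic submodules of ${}^2T_n$. The orbits of this action on the set of free cyclic submodules are called $GL_2(T_n)$-orbits. A pair $(A,B)\in{}^2T_n$, $A=(a_{ij})$, $B=(b_{ij})$, is here called distinguished (the paper marks such pairs by a special typeface) if for all $i=1,\dots,n$ and $j=1,\dots,i-1$: $a_{ii}\in\{0,1\}$, $b_{ij}\in\{0,1\}$, $a_{ij}=0$, $b_{ii}=0$; and the number of non-zero entries of the $n\times 2n$ matrix $[A|B]$ is equal to its rank, which is $n$. Every distinguished pair generates a free cyclic submodule. *)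

(* Defs.v *)
From HB Require Import structures.
From mathcomp Require Import all_boot all_order all_algebra.
From mathcomp Require Import boolp classical_sets.

Set Implicit Arguments.
Unset Strict Implicit.
Unset Printing Implicit Defensive.

Import GRing.Theory.
Local Open Scope ring_scope.
Local Open Scope classical_set_scope.

(* [is_trig_mx] means that the entries (i, j) with i < j vanish. *)
Definition lower_trig (F : fieldType) (n : nat) : {pred 'M[F]_n} :=
  fun A => is_trig_mx A.

Lemma lower_trig_subring (F : fieldType) (n : nat) :
  subring_closed (@lower_trig F n).
Proof.
split; first exact: scalar_mx_is_trig.
- move=> A B /is_trig_mxP At /is_trig_mxP Bt; apply/is_trig_mxP => i j ij.
  by rewrite !mxE At // Bt // subr0.
- move=> A B /is_trig_mxP At /is_trig_mxP Bt; apply/is_trig_mxP => i j ij.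
  rewrite mxE big1 // => k _.
  have [ik|ki] := ltnP i k; first by rewrite At // mul0r.
  by rewrite Bt ?mulr0 //; exact: leq_ltn_trans ki ij.
Qed.

(* The ring T_n; it is a pzRingType, hence so is 'M[T F n]_2. *)
Record T (F : fieldType) (n : nat) := LowerTrig {
  T_mx :> 'M[F]_n;
  T_mxP : lower_trig T_mx }.

HB.instance Definition _ (F : fieldType) (n : nat) :=
  [isSub for @T_mx F n].
HB.instance Definition _ (F : fieldType) (n : nat) :=
  [Choice of T F n by <:].
HB.instance Definition _ (F : fieldType) (n : nat) :=
  GRing.SubChoice_isSubPzRing.Build 'M[F]_n (@lower_trig F n) (T F n)
    (@lower_trig_subring F n).

Definition lscale (F : fieldType) (n : nat) (X : T F n) (p : T F n * T F n) :
    T F n * T F n :=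
  (X * p.1, X * p.2).

Definition cyclic_submod (F : fieldType) (n : nat) (p : T F n * T F n) :
    set (T F n * T F n) :=
  [set lscale X p | X in setT].

Definition generates_free (F : fieldType) (n : nat) (p : T F n * T F n) : Prop :=
  forall X : T F n, lscale X p = (0, 0) -> X = 0.

Definition free_cyclic_submods (F : fieldType) (n : nat) :
    set (set (T F n * T F n)) :=
  [set cyclic_submod p | p in @generates_free F n].

(* [unitmx] is unavailable because T_n is not commutative. *)
Definition GL2 (F : fieldType) (n : nat) : set 'M[T F n]_2 :=
  [set G | exists H : 'M[T F n]_2, G *m H = 1%:M /\ H *m G = 1%:M].

Definition act (F : fieldType) (n : nat) (G : 'M[T F n]_2)
    (p : T F n * T F n) : T F n * T F n :=
  (p.1 * G ord0 ord0 + p.2 * G ord_max ord0,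
   p.1 * G ord0 ord_max + p.2 * G ord_max ord_max).

Definition GL2_orbit (F : fieldType) (n : nat) (M : set (T F n * T F n)) :
    set (set (T F n * T F n)) :=
  [set act G @` M | G in @GL2 F n].

Definition GL2_orbits (F : fieldType) (n : nat) :
    set (set (set (T F n * T F n))) :=
  [set GL2_orbit M | M in @free_cyclic_submods F n].

(* As [GL2_orbits] only contains orbits of free cyclic submodules, this
   includes the freeness of M and N. *)
Definition represent_distinct_orbits (F : fieldType) (n : nat)
    (M N : set (T F n * T F n)) : Prop :=
  exists O1 O2 : set (set (T F n * T F n)),
    [/\ GL2_orbits O1, GL2_orbits O2, O1 M, O2 N & O1 <> O2].

Definition nonzero_entries (F : fieldType) (m n : nat) (A : 'M[F]_(m, n)) : nat :=
  #|[pred ij : 'I_m * 'I_n | A ij.1 ij.2 != 0]|.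

(* The diagonal conditions are imposed for every i, including the first row,
   where there is no j < i. *)
Definition distinguished (F : fieldType) (n : nat) (p : T F n * T F n) : Prop :=
  let A : 'M[F]_n := p.1 in
  let B : 'M[F]_n := p.2 in
  [/\ forall i : 'I_n, (A i i = 0 \/ A i i = 1) /\ B i i = 0,
      forall i j : 'I_n, (j < i)%N -> (B i j = 0 \/ B i j = 1) /\ A i j = 0,
      nonzero_entries (row_mx A B) = \rank (row_mx A B)
    & \rank (row_mx A B) = n].

(* Main.v *)
(* Left multiplication by T_n turns each row into a combination of that row and
   earlier ones, and the right action of GL_2(T_n) turns the j-th columns of A
   and B into combinations of their columns of index >= j.  Hence, for all i and j, the rank of the
   part of [A|B] formed by the first i rows and by the columns of A and of B of
   index >= j is an invariant of the orbit.  Each row of a distinguished pair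
   has a single non-zero entry, so this rank counts the rows k < i whose entry
   lies in a column of index >= j.  These numbers determine the column index of
   the entry of each row, and its position decides between A (diagonal) and B
   (below the diagonal). *)
Require Import Defs.
From mathcomp Require Import all_boot all_order all_algebra.
From mathcomp Require Import boolp classical_sets.

Set Implicit Arguments.
Unset Strict Implicit.
Unset Printing Implicit Defensive.

Import GRing.Theory.

(** Passing from [i = k0] to [i = k0.+1] changes the count by the truth value of [j <= f k0], and
    these truth values for all [j] determine [f k0]. *)
Lemma card_threshold_inj (n : nat) (f g : 'I_n -> nat) :
    (forall i j : nat, #|[pred k : 'I_n | (k < i) && (j <= f k)]|
                     = #|[pred k : 'I_n | (k < i) && (j <= g k)]|) ->
  f =1 g.
Proof.
move=> fg k0.
have step (h : 'I_n -> nat) j : #|[pred k : 'I_n | (k < k0.+1) && (j <= h k)]|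
    = (j <= h k0) + #|[pred k : 'I_n | (k < k0) && (j <= h k)]|.
  rewrite (cardD1 k0) inE ltnSn; congr (_ + _).
  by apply: eq_card => k; rewrite !inE -val_eqE /= ltnS ltn_neqAle -andbA.
have thr j : (j <= f k0) = (j <= g k0).
  have := fg k0.+1 j; rewrite !step fg => /addIn.
  by do 2 case: (_ <= _).
by apply/eqP; rewrite eqn_leq -thr leqnn thr leqnn.
Qed.

(** * Ranks and row-free matrices over a field *)

Local Open Scope ring_scope.

Lemma mxrank_diag (F : fieldType) (n : nat) (d : 'rV[F]_n) :
  \rank (diag_mx d) = #|[pred i | d ord0 i != 0]|.
Proof.
rewrite -sum1_card big_mkcond /=.
elim: n d => [|n IHn] d; first by rewrite thinmx0 mxrank0 big_ord0.
(* [e] is [d] with its length read as [1 + n], so that the first entry can be split off as a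
   block. *)
pose e : 'rV_(1 + n) := d; rewrite big_ord_recl.
have -> : \rank (diag_mx d) = \rank (block_mx (d ord0 ord0)%:M 0 0
                                       (diag_mx (rsubmx e)) : 'M_(1 + n)).
  have := diag_mx_row (lsubmx e) (rsubmx e); rewrite hsubmxK => eE.
  rewrite -[diag_mx d]/(diag_mx e) eE [diag_mx (lsubmx e)]mx11_scalar.
  by rewrite !mxE eqxx mulr1n (_ : lshift n ord0 = ord0) //; apply: val_inj.
rewrite rank_diag_block_mx IHn; congr (_ + _)%N.
  rewrite inE; have [->|d0] := eqVneq (d ord0 ord0) 0.
    by rewrite raddf0 mxrank0.
  by rewrite -scalemx1 mxrank_scale_nz ?mxrank1.
apply: eq_bigr => i _; rewrite !inE mxE.
by rewrite (_ : rshift 1 i = lift ord0 i) //; apply: val_inj.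
Qed.

Lemma row_free_row_neq0 (F : fieldType) (m n : nat) (M : 'M[F]_(m, n)) i :
  row_free M -> exists j, M i j != 0.
Proof.
move=> /row_free_inj Minj; apply/existsP; apply: contraT => /existsPn M0.
have /Minj/matrixP/(_ ord0 i) : delta_mx ord0 i *m M = 0 *m M :> 'rV_n.
  rewrite -rowE mul0mx; apply/rowP=> j; rewrite !mxE.
  by have := M0 j; rewrite negbK => /eqP.
by rewrite !mxE !eqxx => /eqP; rewrite oner_eq0.
Qed.

(** Row-freeness puts at least one non-zero entry in each of the [m] rows. As there are only [m]
    such entries in all, the equality case of the summed inequalities leaves exactly one per row. *)
Lemma row_free_unique_nonzero (F : fieldType) (m n : nat) (M : 'M[F]_(m, n)) :
    row_free M -> nonzero_entries M = m ->
  exists c : 'I_m -> 'I_n, forall i j, (M i j != 0) = (j == c i).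
Proof.
move=> Mfree Mcard.
have sumE : (\sum_(i < m) 1 = \sum_(i < m) #|[pred j | M i j != 0%R]|)%N.
  rewrite sum1_card card_ord -[LHS]Mcard /nonzero_entries -sum1_card.
  under [RHS]eq_bigr do rewrite -sum1_card.
  by rewrite pair_big_dep.
have /leqif_sum[_] : forall i : 'I_m, xpredT i ->
    (1 <= #|[pred j | M i j != 0%R]|
       ?= iff (1 == #|[pred j | M i j != 0%R]|))%N.
  move=> i _; split=> //; have [j Mij] := row_free_row_neq0 i Mfree.
  by apply/card_gt0P; exists j.
rewrite sumE eqxx => /esym/forallP row1.
suff /choice[c cP] : forall i : 'I_m, exists c, forall j, (M i j != 0) = (j == c).
  by exists c.
move=> i; have /implyP/(_ isT)/eqP/esym/mem_card1[c cP] := row1 i.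
by exists c => j; have := cP j; rewrite !inE.
Qed.

(** * The right action of GL_2(T_n) and its orbits *)

Section TriangularPairs.

Variables (F : fieldType) (n : nat).
Implicit Types (X : T F n) (p q : T F n * T F n) (G H : 'M[T F n]_2).

Lemma T_mx_upper0 X (i j : 'I_n) : (i < j)%N -> T_mx X i j = 0.
Proof. by move: i j; apply/is_trig_mxP; exact: T_mxP. Qed.

Lemma act1 p : act 1%:M p = p.
Proof.
by case: p => A B; rewrite /act !mxE /= mulr1n mulr0n !mulr1 !mulr0 addr0 add0r.
Qed.

Lemma act_mul G H p : act H (act G p) = act (G *m H) p.
Proof.
have mulE i j : (G *m H) i j = G i ord0 * H ord0 j + G i ord_max * H ord_max j.
  rewrite mxE big_ord_recl big_ord1 (_ : lift ord0 ord0 = ord_max) //.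
  exact: val_inj.
rewrite /act /= !mulE; congr (_, _); rewrite !mulrDr !mulrDl !mulrA;
by rewrite addrACA.
Qed.

Lemma lscale1 p : lscale 1 p = p.
Proof. by case: p => A B; rewrite /lscale !mul1r. Qed.

Lemma cyclic_submod_refl p : cyclic_submod p p.
Proof. by exists 1 => //; rewrite lscale1. Qed.

Lemma GL2_1 : @GL2 F n 1%:M.
Proof. by exists 1%:M; rewrite mulmx1. Qed.

Lemma GL2_mul G H : GL2 G -> GL2 H -> GL2 (G *m H).
Proof.
move=> [G' [GG' G'G]] [H' [HH' H'H]]; exists (H' *m G').
by rewrite mulmxA -(mulmxA G) HH' mulmx1 GG' mulmxA -(mulmxA H') G'G mulmx1 H'H.
Qed.

Local Open Scope classical_set_scope.

Lemma image_act_mul G H (M : set (T F n * T F n)) :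
  act H @` (act G @` M) = act (G *m H) @` M.
Proof.
rewrite image_comp; congr (image _ _); apply/funext => p.
exact: act_mul.
Qed.

Lemma image_act1 (M : set (T F n * T F n)) : act 1%:M @` M = M.
Proof.
by rewrite -[RHS]image_id; congr (image _ _); apply/funext => p; exact: act1.
Qed.

Lemma GL2_orbit_refl (M : set (T F n * T F n)) : GL2_orbit M M.
Proof. by exists 1%:M; [exact: GL2_1 | exact: image_act1]. Qed.

Lemma GL2_orbit_eq (M N : set (T F n * T F n)) :
  GL2_orbit M N -> GL2_orbit N = GL2_orbit M.
Proof.
move=> [G GLG <-]; have [G' [GG' G'G]] := GLG.
have GLG' : GL2 G' by exists G.
apply/seteqP; split=> _ [H GLH <-].
  by exists (G *m H); [exact: GL2_mul | rewrite image_act_mul].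
(* The inverse [G'] first undoes [G], leading back to [M], and then [H] acts. *)
exists (G' *m H); first exact: GL2_mul.
by rewrite image_act_mul mulmxA GG' mul1mx.
Qed.

Local Close Scope classical_set_scope.

(** * The shape of distinguished pairs *)

Lemma distinguished_row_free p :
  distinguished p -> row_free (row_mx (T_mx p.1) (T_mx p.2)).
Proof. by case=> _ _ _ rk; rewrite /row_free rk. Qed.

Lemma distinguished_generates_free p : distinguished p -> generates_free p.
Proof.
move=> /distinguished_row_free/row_free_inj pinj X Xp0.
have X1 : T_mx (X * p.1) = 0.
  by exact: (congr1 (fun q : T F n * T F n => T_mx q.1) Xp0).
have X2 : T_mx (X * p.2) = 0.
  by exact: (congr1 (fun q : T F n * T F n => T_mx q.2) Xp0).
apply: val_inj; apply: (pinj _ (T_mx X) 0).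
rewrite mul_mx_row mul0mx -[RHS]row_mx0.
by congr row_mx; [exact: X1 | exact: X2].
Qed.

(** Row [i] of [A|B] has a single non-zero entry, equal to 1, and [f i] is its column counted within
    its own block. The block need not be recorded: the entry lies in A exactly when [f i = i]. *)
Lemma distinguished_entries p : distinguished p ->
  exists f : 'I_n -> 'I_n,
    forall i j, T_mx p.1 i j = ((j == f i) && (j == i))%:R
             /\ T_mx p.2 i j = ((j == f i) && (j != i))%:R.
Proof.
move=> dp; have pfree := distinguished_row_free dp.
case: dp => diag low; case: p diag low pfree => A B /= diag low pfree ne rk.
rewrite rk in ne; have [c cP] := row_free_unique_nonzero pfree ne.
have A01 i j : T_mx A i j = (T_mx A i j != 0)%:R /\ (T_mx A i j != 0 -> j = i).
  have [ij|ji|/val_inj ->] := ltngtP i j.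
  - by rewrite T_mx_upper0 // eqxx.
  - by have [_ ->] := low i j ji; rewrite eqxx.
  - by have [[->|->] _] := diag j; rewrite ?eqxx ?oner_eq0.
have B01 i j : T_mx B i j = (T_mx B i j != 0)%:R /\ (T_mx B i j != 0 -> j != i).
  have [ij|ji|/val_inj ->] := ltngtP i j.
  - by rewrite T_mx_upper0 // eqxx.
  - have [Bij _] := low i j ji.
    by split; [case: Bij => ->; rewrite ?eqxx ?oner_eq0
              | move=> _; rewrite -val_eqE /= neq_ltn ji].
  - by have [_ ->] := diag j; rewrite eqxx.
exists (fun i => match split (c i) with inl j => j | inr j => j end) => i j.
have [-> A0] := A01 i j; have [-> B0] := B01 i j.
have Ac k : (T_mx A i k != 0) = (lshift n k == c i) by rewrite -cP row_mxEl.
have Bc k : (T_mx B i k != 0) = (rshift n k == c i) by rewrite -cP row_mxEr.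
case: splitP Ac Bc => l cl Ac Bc.
  have {}cl : c i = lshift n l by apply: val_inj.
  have li : l = i by have [_ ->] := A01 i l; rewrite // Ac cl.
  by rewrite Ac Bc cl eq_lshift eq_rlshift li; case: eqP.
have {}cl : c i = rshift n l by apply: val_inj.
have li : l != i by have [_ ->] := B01 i l; rewrite // Bc cl.
rewrite Ac Bc cl eq_rshift eq_lrshift; have [->|//] := eqVneq j l.
by rewrite li (negPf li).
Qed.

(** * Ranks of corners as orbit invariants *)

Definition first_rows (i : nat) : 'M[F]_n := diag_mx (\row_k (k < i)%:R).
Definition last_cols (j : nat) : 'M[F]_n := diag_mx (\row_k (j <= k)%:R).

(** A row [a < i] of a lower triangular matrix is supported in columns [b <= a < i]. *)
Lemma first_rows_trig i X :
  first_rows i *m T_mx X *m first_rows i = first_rows i *m T_mx X.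
Proof.
apply/matrixP=> a b; rewrite mul_mx_diag mul_diag_mx !mxE.
have [ab|ba] := ltnP a b.
  by rewrite (T_mx_upper0 X ab) mulr0 mul0r.
by have [ai|ia] := ltnP a i; [rewrite (leq_ltn_trans ba ai) mulr1 | rewrite !mul0r].
Qed.

(** A column [b >= j] of a lower triangular matrix is supported in rows [a >= b >= j]. *)
Lemma last_cols_trig j X :
  last_cols j *m (T_mx X *m last_cols j) = T_mx X *m last_cols j.
Proof.
apply/matrixP=> a b; rewrite mul_mx_diag mul_diag_mx !mxE.
have [ab|ba] := ltnP a b.
  by rewrite (T_mx_upper0 X ab) mul0r mulr0.
by have [jb|bj] := leqP j b; [rewrite (leq_trans jb ba) mul1r | rewrite !mulr0].
Qed.

(** Rows and columns outside the corner are zeroed rather than deleted: the rank is the same, the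
    size stays fixed and truncation is a matrix product. *)
Definition corner (i j : nat) p : 'M[F]_(n, n + n) :=
  row_mx (first_rows i *m T_mx p.1 *m last_cols j)
         (first_rows i *m T_mx p.2 *m last_cols j).

Lemma mxrank_corner_act i j G X p :
  (\rank (corner i j (act G (lscale X p))) <= \rank (corner i j p))%N.
Proof.
pose Q := last_cols j; pose P := first_rows i.
have -> : corner i j (act G (lscale X p)) =
    P *m T_mx X *m corner i j p *m
      block_mx (T_mx (G ord0 ord0) *m Q) (T_mx (G ord0 ord_max) *m Q)
               (T_mx (G ord_max ord0) *m Q) (T_mx (G ord_max ord_max) *m Q).
  (* Triangularity allows [P] to be inserted after [X] and [Q] before [Y], so the new corner is a
     two-sided multiple of the old one. *)
  have cornerE (A Y : T F n) : P *m T_mx (X * A * Y) *m Q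
      = P *m T_mx X *m (P *m T_mx A *m Q) *m (T_mx Y *m Q).
    by rewrite !mulmxA first_rows_trig -2![in RHS]mulmxA last_cols_trig !mulmxA.
  rewrite /corner mul_mx_row mul_row_block -!cornerE.
  by rewrite -!mulmxDl -!mulmxDr.
by apply: leq_trans (mxrankM_maxl _ _) (mxrankM_maxr _ _).
Qed.

(** Row [k] of both blocks is supported in column [f k], so cutting off columns keeps or kills it as
    a whole. The corner is thus a 0-1 diagonal matrix times a row-free one, and its rank is that of
    the diagonal factor. *)
Lemma mxrank_corner i j p (f : 'I_n -> 'I_n) :
    row_free (row_mx (T_mx p.1) (T_mx p.2)) ->
    (forall k l, l != f k -> T_mx p.1 k l = 0 /\ T_mx p.2 k l = 0) ->
  \rank (corner i j p) = #|[pred k : 'I_n | (k < i) && (j <= f k)]|%N.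
Proof.
move=> pfree psupp.
have -> : corner i j p = diag_mx (\row_k ((k < i) && (j <= f k))%N%:R)
    *m row_mx (T_mx p.1) (T_mx p.2).
  rewrite mul_mx_row; congr row_mx; apply/matrixP=> k l;
  rewrite mul_mx_diag !mul_diag_mx !mxE; have [->|/psupp[p1 p2]] := eqVneq l (f k);
  by rewrite ?p1 ?p2 ?mulr0 ?mul0r // mulrAC -natrM mulnb.
rewrite mxrankMfree // mxrank_diag; apply: eq_card => k.
by rewrite !inE !mxE; case: (_ && _); rewrite ?oner_eq0 ?eqxx.
Qed.

Lemma distinguished_corner_inj p q : distinguished p -> distinguished q ->
  (forall i j, \rank (corner i j p) = \rank (corner i j q)) -> p = q.
Proof.
move=> dp dq pq.
have [f fP] := distinguished_entries dp; have [g gP] := distinguished_entries dq.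
have fg : f =1 g.
  suff fgn : (fun k => f k : nat) =1 (fun k => g k : nat).
    by move=> k; apply/val_inj/fgn.
  apply: card_threshold_inj => i j.
  rewrite -(@mxrank_corner i j p f) ?distinguished_row_free //; last first.
    by move=> k l /negPf kl; have [-> ->] := fP k l; rewrite kl.
  rewrite -(@mxrank_corner i j q g) ?distinguished_row_free //.
  by move=> k l /negPf kl; have [-> ->] := gP k l; rewrite kl.
case: p q fP gP {dp dq pq} => [A B] [C D] /= fP gP.
by congr (_, _); apply/val_inj/matrixP=> k l /=;
  have [AE BE] := fP k l; have [CE DE] := gP k l; rewrite ?AE ?BE ?CE ?DE fg.
Qed.

Lemma mxrank_corner_orbit i j p q :
    GL2_orbit (cyclic_submod p) (cyclic_submod q) ->
  (\rank (corner i j q) <= \rank (corner i j p))%N.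
Proof.
move=> [G _ E]; have := cyclic_submod_refl q.
by rewrite -E => -[_ [X _ <-] <-]; exact: mxrank_corner_act.
Qed.

End TriangularPairs.

Theorem theorem1 (F : fieldType) (n : nat) (hn : (2 <= n)%N)
    (A B C D : T F n) (hAB : distinguished (A, B)) (hCD : distinguished (C, D)) :
  represent_distinct_orbits (cyclic_submod (A, B)) (cyclic_submod (C, D))
  <-> (A, B) <> (C, D).
Proof.
split=> [[O1 [O2 [[M _ <-] [N _ <-] OM ON neq]]] eqp | neq].
  (* Each orbit equals the orbit of any of its members, so two orbits with a common member
     coincide. *)
  by apply: neq; rewrite -(GL2_orbit_eq OM) -(GL2_orbit_eq ON) eqp.
have orb p : distinguished p -> GL2_orbits (GL2_orbit (cyclic_submod p)).
  move=> dp; exists (cyclic_submod p) => //; exists p => //.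
  exact: distinguished_generates_free.
exists (GL2_orbit (cyclic_submod (A, B))), (GL2_orbit (cyclic_submod (C, D))).
split; [exact: orb | exact: orb | exact: GL2_orbit_refl
       | exact: GL2_orbit_refl | move=> eqO].
apply: neq; apply: distinguished_corner_inj => // i j.
(* Corner ranks cannot grow within an orbit. When the orbits agree, each submodule lies in the orbit
   of the other, and the two inequalities give equality. *)
apply/eqP; rewrite eqn_leq; apply/andP; split; apply: mxrank_corner_orbit.
- by rewrite -eqO; exact: GL2_orbit_refl.
- by rewrite eqO; exact: GL2_orbit_refl.
Qed.
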